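(* Let $\{\omega^k=(x^k,\lambda^k)\}_{k\ge 0}$ be the sequence generated by the penalty dual-primal (balanced) augmented Lagrangian method described in the context, and let $$H=\begin{pmatrix}\beta A^\top A+Q & -A^\top\\ -A & \frac1\beta I\end{pmatrix}.$$ For any integer $t>0$ define $\tilde\omega_t=(\tilde x_t,\tilde\lambda_t):=\frac{1}{t+1}\sum_{k=0}^t\omega^{k+1}$. Then $\tilde\omega_t\in\Omega$ and $$\theta(\tilde x_t)-\theta(x)+(\tilde\omega_t-\omega)^\top F(\omega)\le\frac{1}{2(t+1)}\|\omega-\omega^0\|_H^2\qquad\text{for all }\omega=(x,\lambda)\in\Omega.$$
   Context: Problem: $\min\{\theta(x) : Ax=b \ (\text{or } Ax\ge b),\ x\in\mathcal{X}\}$, assumed to have a solution, where $\theta:\mathbb{R}^n\to\mathbb{R}$ is a closed proper convex (not necessarily smooth) function, $\mathcal{X}\subset\mathbb{R}^n$ is a nonempty closed convex set, $A\in\mathbb{R}^{m\times n}$, $b\in\mathbb{R}^m$, and $\ge$ is componentwise. Put $\Lambda=\mathbb{R}^m$ if the constraint is $Ax=b$ and $\Lambda=\mathbb{R}^m_+$ if the constraint is $Ax\ge b$; $\Omega=\mathcal{X}\times\Lambda$; for $\omega=(x,\lambda)$ put $F(\omega)=(-A^\top\lambda,\ Ax-b)$. For a symmetric matrix $M$, $\|v\|_M^2=v^\top Mv$. Method (for both types of constraint): fix $\beta>0$ and an arbitrary symmetric positive definite matrix $Q\in\mathbb{R}^{n\times n}$. Given $(x^k,\lambda^k)$, set $$\lambda^{k+1}=\lambda^k-\beta(Ax^k-b),$$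 $$x^{k+1}=\arg\min\Big\{\theta(x)-\langle 2\lambda^{k+1}-\lambda^k,Ax-b\rangle+\tfrac{\beta}{2}\|A(x-x^k)\|^2+\tfrac12\|x-x^k\|_Q^2 : x\in\mathcal{X}\Big\}.$$
   Formalization: For Ax≥b, ω̃_t∈Ω can fail for the method as written (λ can become negative); there it is asserted only if λ^{k+1}∈Λ for all k≤t. The inequality holds unconditionally, and the full claim is also proved when the multiplier step is projected onto Λ. *)

(* Defs.v *)
From HB Require Import structures.
From mathcomp Require Import all_boot all_order all_algebra.
From mathcomp Require Import all_classical all_reals all_analysis.
Set Implicit Arguments.
Unset Strict Implicit.
Unset Printing Implicit Defensive.
Import Order.TTheory GRing.Theory Num.Theory.
Import numFieldNormedType.Exports.
Local Open Scope classical_set_scope.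
Local Open Scope ring_scope.

Section LinearAlgebra.
Variable R : realType.

Definition dotv n (u v : 'cV[R]_n) : R := (u^T *m v) 0 0.

(* [sqnorm_mx M v] is the squared M-(semi)norm v^T M v. *)
Definition sqnorm_mx n (M : 'M[R]_n) (v : 'cV[R]_n) : R :=
  (v^T *m M *m v) 0 0.

Definition sym_posdef n (M : 'M[R]_n) : Prop :=
  M^T = M /\ forall v : 'cV[R]_n, v != 0 -> 0 < sqnorm_mx M v.

End LinearAlgebra.

Definition argmin (R : realType) (T : Type) (D : set T) (f : T -> R) : set T :=
  [set x | D x /\ forall y, D y -> f x <= f y].

(* Properness is automatic for a real-valued function; closedness is lower
   semicontinuity of its embedding in the extended reals. *)
Definition closed_convex_fun (R : realType) n (theta : 'cV[R]_n -> R) : Prop :=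
  convex_function setT theta /\ lower_semicontinuous (EFin \o theta).

(* [EqC] is the constraint A x = b, [GeC] the constraint A x >= b. *)
Inductive constraint_kind := EqC | GeC.

Section Problem.
Variables (R : realType) (n m : nat).
Variables (c : constraint_kind) (theta : 'cV[R]_n -> R) (X : set 'cV[R]_n).
Variables (A : 'M[R]_(m, n)) (b : 'cV[R]_m).

Definition feasible : set 'cV[R]_n :=
  [set x | X x /\ match c with
                  | EqC => A *m x = b
                  | GeC => forall i, b i 0 <= (A *m x) i 0
                  end].

Definition Lambda : set 'cV[R]_m :=
  match c with
  | EqC => setT
  | GeC => [set lam | forall i, 0 <= lam i 0]
  end.

(* The Euclidean projection onto Lambda. *)
Definition proj_Lambda (lam : 'cV[R]_m) : 'cV[R]_m :=
  match c with
  | EqC => lam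
  | GeC => map_mx (Num.max 0) lam
  end.

(* Points w = (x, lam) are stacked columns: x = usubmx w, lam = dsubmx w. *)
Definition Omega : set 'cV[R]_(n + m) :=
  [set w | X (usubmx w) /\ Lambda (dsubmx w)].

Definition F (w : 'cV[R]_(n + m)) : 'cV[R]_(n + m) :=
  col_mx (- (A^T *m dsubmx w)) (A *m usubmx w - b).

Variables (beta : R) (Q : 'M[R]_n).

Definition H : 'M[R]_(n + m) :=
  block_mx (beta *: (A^T *m A) + Q) (- A^T) (- A) (beta^-1)%:M.

Definition dual_step (w : 'cV[R]_(n + m)) : 'cV[R]_m :=
  dsubmx w - beta *: (A *m usubmx w - b).

(* The set of minimizers of the primal subproblem at the iterate w, given the
   new multiplier lam'. *)
Definition primal_step (w : 'cV[R]_(n + m)) (lam' : 'cV[R]_m) :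
    set 'cV[R]_n :=
  argmin X (fun x =>
    theta x - dotv (2 *: lam' - dsubmx w) (A *m x - b)
    + beta / 2 * sqnorm_mx 1%:M (A *m (x - usubmx w))
    + 1 / 2 * sqnorm_mx Q (x - usubmx w)).

(* The initial point w 0 is unrestricted. *)
Definition dual_primal_seq (w : nat -> 'cV[R]_(n + m)) : Prop :=
  forall k : nat,
    dsubmx (w k.+1) = dual_step (w k) /\
    primal_step (w k) (dsubmx (w k.+1)) (usubmx (w k.+1)).

(* The same method with the new multiplier projected onto Lambda; it coincides
   with [dual_primal_seq] for equality constraints. *)
Definition proj_dual_primal_seq (w : nat -> 'cV[R]_(n + m)) : Prop :=
  forall k : nat,
    dsubmx (w k.+1) = proj_Lambda (dual_step (w k)) /\
    primal_step (w k) (dsubmx (w k.+1)) (usubmx (w k.+1)).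

Definition ergodic_mean (w : nat -> 'cV[R]_(n + m)) (t : nat) :
    'cV[R]_(n + m) :=
  (t.+1%:R)^-1 *: \sum_(k < t.+1) w k.+1.

Definition ergodic_bound (w : nat -> 'cV[R]_(n + m)) (t : nat) : Prop :=
  forall z : 'cV[R]_(n + m), Omega z ->
    theta (usubmx (ergodic_mean w t)) - theta (usubmx z)
      + dotv (ergodic_mean w t - z) (F z)
    <= 1 / (2 * t.+1%:R) * sqnorm_mx H (z - w 0).

End Problem.

(* Main.v *)
(* One iteration is a proximal step in the H-norm: the optimality conditions of
   the two updates add up to
     theta(x) - theta(x^{k+1}) + (w - w^{k+1})^T F(w^{k+1})
       + (w - w^{k+1})^T H (w^{k+1} - w^k) >= 0    for all w in Omega.
   The linear part of F is skew, so F(w^{k+1}) may be replaced by F(w); the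
   three-point identity turns the last term into half of
     |w - w^k|_H^2 - |w - w^{k+1}|_H^2 - |w^{k+1} - w^k|_H^2,
   which telescopes because H is positive semidefinite.  Averaging over k and
   Jensen's inequality for theta give the bound. *)
Require Import Defs.
From HB Require Import structures.
From mathcomp Require Import all_boot all_order all_algebra.
From mathcomp Require Import all_classical all_reals all_analysis.
From mathcomp Require Import ring lra.
Import Order.TTheory GRing.Theory Num.Theory.
Import numFieldNormedType.Exports.
Local Open Scope classical_set_scope.
Local Open Scope ring_scope.

Set Implicit Arguments.
Unset Strict Implicit.
Unset Printing Implicit Defensive.

(** * Bilinear algebra of the inner product *)

Section InnerProduct.
Variable R : realType.
Implicit Type n : nat.

Lemma dotvE n (u v : 'cV[R]_n) : dotv u v = \sum_i u i 0 * v i 0.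
Proof. by rewrite /dotv mxE; apply: eq_bigr => i _; rewrite mxE. Qed.

Lemma dotvC n (u v : 'cV[R]_n) : dotv u v = dotv v u.
Proof. by rewrite !dotvE; apply: eq_bigr => i _; rewrite mulrC. Qed.

Lemma dotvDr n (u v w : 'cV[R]_n) : dotv u (v + w) = dotv u v + dotv u w.
Proof. by rewrite /dotv mulmxDr mxE. Qed.

Lemma dotvNr n (u v : 'cV[R]_n) : dotv u (- v) = - dotv u v.
Proof. by rewrite /dotv mulmxN mxE. Qed.

Lemma dotvZr n a (u v : 'cV[R]_n) : dotv u (a *: v) = a * dotv u v.
Proof. by rewrite /dotv -scalemxAr mxE. Qed.

Lemma dotv0r n (u : 'cV[R]_n) : dotv u 0 = 0.
Proof. by rewrite /dotv mulmx0 mxE. Qed.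

Lemma dotvDl n (u v w : 'cV[R]_n) : dotv (u + v) w = dotv u w + dotv v w.
Proof. by rewrite ![dotv _ w]dotvC dotvDr. Qed.

Lemma dotvNl n (u v : 'cV[R]_n) : dotv (- u) v = - dotv u v.
Proof. by rewrite ![dotv _ v]dotvC dotvNr. Qed.

Lemma dotvZl n a (u v : 'cV[R]_n) : dotv (a *: u) v = a * dotv u v.
Proof. by rewrite ![dotv _ v]dotvC dotvZr. Qed.

Definition dotv_lin := (dotvDl, dotvDr, dotvNl, dotvNr, dotvZl, dotvZr).

Lemma dotv_suml n (I : Type) (r : seq I) (u : I -> 'cV[R]_n) v :
  dotv (\sum_(i <- r) u i) v = \sum_(i <- r) dotv (u i) v.
Proof. by rewrite /dotv raddf_sum mulmx_suml summxE. Qed.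

Lemma dotv_ge0 n (u : 'cV[R]_n) : 0 <= dotv u u.
Proof. by rewrite dotvE sumr_ge0 // => i _; rewrite -expr2 sqr_ge0. Qed.

Lemma dotv_trmx n p (A : 'M[R]_(p, n)) u v :
  dotv u (A^T *m v) = dotv (A *m u) v.
Proof. by rewrite /dotv trmx_mul mulmxA. Qed.

Lemma dotv_col_mx n p (u u' : 'cV[R]_n) (v v' : 'cV[R]_p) :
  dotv (col_mx u v) (col_mx u' v') = dotv u u' + dotv v v'.
Proof. by rewrite /dotv tr_col_mx mul_row_col mxE. Qed.

Lemma sqnorm_mxE n (M : 'M[R]_n) v : sqnorm_mx M v = dotv v (M *m v).
Proof. by rewrite /sqnorm_mx /dotv mulmxA. Qed.

Lemma dotv_sym n (M : 'M[R]_n) u v :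
  M^T = M -> dotv u (M *m v) = dotv v (M *m u).
Proof. by move=> MT; rewrite -{1}MT dotv_trmx dotvC. Qed.

(** Polarization of [z - v = (z - u) + (u - v)]; symmetry of [M] merges the two cross terms. *)
Lemma three_point n (M : 'M[R]_n) (u v z : 'cV[R]_n) : M^T = M ->
  2 * dotv (z - u) (M *m (u - v)) =
    sqnorm_mx M (z - v) - sqnorm_mx M (z - u) - sqnorm_mx M (u - v).
Proof.
move=> MT; rewrite !sqnorm_mxE !mulmxBr !dotv_lin.
rewrite (dotv_sym v z MT) (dotv_sym u z MT) (dotv_sym v u MT); ring.
Qed.

End InnerProduct.

(** * Averages under convexity, and first-order optimality along segments *)

Section Convexity.
Variables (R : realType) (E : lmodType R).

Lemma convex_setP (D : set E) : convex_set D ->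
  forall (s : R) x y, 0 <= s -> s <= 1 -> D x -> D y ->
    D (s *: x + (1 - s) *: y).
Proof.
move=> cD s x y s0 s1 Dx Dy.
by have := cD x y (Itv01 s0 s1); rewrite !inE; apply.
Qed.

Lemma convex_functionP (f : E -> R) : convex_function setT f ->
  forall (s : R) x y, 0 <= s -> s <= 1 ->
    f (s *: x + (1 - s) *: y) <= s * f x + (1 - s) * f y.
Proof.
move=> cf s x y s0 s1.
by have := cf (Itv01 s0 s1) x y; rewrite !inE; apply.
Qed.

Definition mean (V : lmodType R) (v : nat -> V) (t : nat) : V :=
  t.+1%:R^-1 *: \sum_(k < t.+1) v k.

Lemma mean0 (V : lmodType R) (v : nat -> V) : mean v 0 = v 0.
Proof. by rewrite /mean big_ord1 invr1 scale1r. Qed.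

(** Reduces convexity of averages to the two-point case: each new mean lies on the segment from the
    old mean to the new point. *)
Lemma mean_recr (V : lmodType R) (v : nat -> V) t :
  mean v t.+1 =
    t.+2%:R^-1 *: v t.+1 + (1 - t.+2%:R^-1) *: mean v t.
Proof.
rewrite /mean big_ord_recr /= addrC scalerDr scalerA; congr (_ + _ *: _).
rewrite -[t.+2%:R]natr1; have : 0 < t.+1%:R :> R by [].
move: (t.+1%:R : R) => x x0; field; rewrite !gt_eqF //; lra.
Qed.

Lemma mean_convex_set (D : set E) (v : nat -> E) t : convex_set D ->
  (forall k, (k <= t)%N -> D (v k)) -> D (mean v t).
Proof.
move=> cD; elim: t => [|t IH] Dv; first by rewrite mean0; exact: Dv.
rewrite mean_recr; apply: convex_setP => //.
- by rewrite invf_le1 ?ltr0n // ler1n.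
- exact: Dv.
- by apply: IH => k kt; apply: Dv; exact: leqW.
Qed.

Lemma mean_convex_function (f : E -> R) (v : nat -> E) t :
  convex_function setT f ->
  f (mean v t) <= t.+1%:R^-1 * \sum_(k < t.+1) f (v k).
Proof.
(* Seen as a mean in the module [R^o], the right side also unfolds by [mean_recr]. *)
move=> cf; change (f (mean v t) <= mean (fun k => f (v k) : R^o) t).
elim: t => [|t IH]; first by rewrite !mean0.
have s1 : t.+2%:R^-1 <= 1 :> R by rewrite invf_le1 ?ltr0n // ler1n.
have s0 : 0 <= t.+2%:R^-1 :> R by rewrite invr_ge0.
rewrite !mean_recr; apply: le_trans (convex_functionP cf _ _ s0 s1) _.
by rewrite lerD2l ler_wpM2l // subr_ge0.
Qed.

Lemma ge0_first_order (a d : R) :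
  (forall s, 0 < s -> s < 1 -> 0 <= s * a + s ^+ 2 * d) -> 0 <= a.
Proof.
move=> h; rewrite leNgt; apply/negP => a0.
have e0 : 0 < `|d| + 1 - a by have := normr_ge0 d; lra.
(* Explicit replacement for letting [s] tend to 0: here [s * |d| < - a / 2], so
   [a + s * d < a / 2 < 0]. *)
pose s := - a / (2 * (`|d| + 1 - a)).
have s0 : 0 < s by rewrite divr_gt0 //; lra.
have s1 : s < 1 by rewrite ltr_pdivrMr; have := normr_ge0 d; lra.
have sE : s * (2 * (`|d| + 1 - a)) = - a by rewrite /s divfK //; lra.
have := h s s0 s1; rewrite expr2 -mulrA -mulrDr pmulr_rge0 // => had.
have : s * d <= s * `|d| by rewrite ler_pM2l // ler_norm.
nra.
Qed.

(** Stands in for a subgradient condition: moving from the minimizer towards [y] cannot decrease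
    [f], so the linear coefficient of any quadratic upper bound is nonnegative. *)
Lemma argmin_first_order (D : set E) (f : E -> R) x y (a d : R) :
  convex_set D -> argmin D f x -> D y ->
  (forall s, 0 < s -> s < 1 ->
    f (s *: y + (1 - s) *: x) <= f x + s * a + s ^+ 2 * d) ->
  0 <= a.
Proof.
move=> cD [Dx xmin] Dy fle; apply: (@ge0_first_order _ d) => s s0 s1.
have := fle s s0 s1; have := xmin _ (convex_setP cD (ltW s0) (ltW s1) Dy Dx).
lra.
Qed.

End Convexity.

(** * The H-form, one iteration, and the sum over iterations *)

Section Iteration.
Variables (R : realType) (n m : nat) (c : constraint_kind).
Variables (theta : 'cV[R]_n -> R) (X : set 'cV[R]_n).
Variables (A : 'M[R]_(m, n)) (b : 'cV[R]_m) (beta : R) (Q : 'M[R]_n).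
Hypothesis theta_convex : convex_function setT theta.
Hypothesis X_convex : convex_set X.
Hypothesis beta_gt0 : 0 < beta.
Hypothesis Q_pd : sym_posdef Q.
Implicit Types w z : 'cV[R]_(n + m).

Lemma usubmxB w z : usubmx (w - z) = usubmx w - usubmx z.
Proof. by apply/matrixP => i j; rewrite !mxE. Qed.

Lemma dsubmxB w z : dsubmx (w - z) = dsubmx w - dsubmx z.
Proof. by apply/matrixP => i j; rewrite !mxE. Qed.

Lemma usubmx_mean (w : nat -> 'cV[R]_(n + m)) t :
  usubmx (mean w t) = mean (fun k => usubmx (w k)) t.
Proof.
apply/matrixP => i j; rewrite !mxE !summxE; congr (_ * _).
by apply: eq_bigr => k _; rewrite mxE.
Qed.

Lemma dsubmx_mean (w : nat -> 'cV[R]_(n + m)) t :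
  dsubmx (mean w t) = mean (fun k => dsubmx (w k)) t.
Proof.
apply/matrixP => i j; rewrite !mxE !summxE; congr (_ * _).
by apply: eq_bigr => k _; rewrite mxE.
Qed.

Lemma dotvE_submx w z :
  dotv w z = dotv (usubmx w) (usubmx z) + dotv (dsubmx w) (dsubmx z).
Proof. by rewrite -{1}(vsubmxK w) -{1}(vsubmxK z) dotv_col_mx. Qed.

Lemma H_sym : (H A beta Q)^T = H A beta Q.
Proof.
rewrite /H tr_block_mx tr_scalar_mx !linearN /= trmxK linearD /= linearZ /=.
by rewrite trmx_mul trmxK Q_pd.1.
Qed.

Lemma dotv_H w z :
  dotv w (H A beta Q *m z) =
    beta * dotv (A *m usubmx w) (A *m usubmx z)
    + dotv (usubmx w) (Q *m usubmx z)
    - dotv (dsubmx z) (A *m usubmx w)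
    - dotv (dsubmx w) (A *m usubmx z)
    + beta^-1 * dotv (dsubmx w) (dsubmx z).
Proof.
rewrite -{1}(vsubmxK w) -{1}(vsubmxK z) /H mul_block_col dotv_col_mx.
rewrite mulmxDl -scalemxAl -mulmxA !mulNmx mul_scalar_mx !dotv_lin.
by rewrite !dotv_trmx (dotvC (A *m _) (dsubmx z)) !addrA.
Qed.

(** Completing the square: the form equals [beta] times the squared norm of [A x - lam / beta], plus
    the squared Q-norm of [x]. *)
Lemma H_ge0 w : 0 <= sqnorm_mx (H A beta Q) w.
Proof.
have Q0 : 0 <= sqnorm_mx Q (usubmx w).
  have [->|/Q_pd.2/ltW //] := eqVneq (usubmx w) 0.
  by rewrite sqnorm_mxE mulmx0 dotv0r.
have := mulr_ge0 (ltW beta_gt0)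
  (dotv_ge0 (A *m usubmx w - beta^-1 *: dsubmx w)).
move: Q0; rewrite !sqnorm_mxE dotv_H !dotv_lin.
rewrite (dotvC (A *m _) (dsubmx w)) => Q0.
by move/(addr_ge0 Q0)/le_trans; apply; rewrite le_eqVlt; apply/orP; left;
  apply/eqP; field; rewrite gt_eqF.
Qed.

(* Up to the factor [beta], the optimality condition of a multiplier update. *)
Definition dual_optimal w z := forall l, Lambda c l ->
  0 <= dotv (l - dsubmx z)
         (beta *: (A *m usubmx w - b) + (dsubmx z - dsubmx w)).

Lemma dual_step_residual w z : dsubmx z = dual_step A b beta w ->
  beta *: (A *m usubmx w - b) + (dsubmx z - dsubmx w) = 0.
Proof.
by move=> ->; rewrite /dual_step [_ - _ - dsubmx w]addrAC subrr sub0r subrr.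
Qed.

Lemma dual_step_optimal w z :
  dsubmx z = dual_step A b beta w -> dual_optimal w z.
Proof. by move/dual_step_residual => h l _; rewrite h dotv0r. Qed.

Lemma proj_dual_step_optimal w z :
  dsubmx z = proj_Lambda c (dual_step A b beta w) -> dual_optimal w z.
Proof.
rewrite /dual_optimal /proj_Lambda.
case: c => [/dual_step_residual -> l _|zE l l0]; first by rewrite dotv0r.
(* The claim becomes the variational inequality of the projection. For the orthant it holds per
   coordinate: [max(0, d) - d] is 0 if [d >= 0], and otherwise the product is [l * (- d)]. *)
set g := beta *: _; have -> : g + (dsubmx z - dsubmx w) =
    dsubmx z - dual_step A b beta w by rewrite /dual_step opprB addrCA.
rewrite zE dotvE sumr_ge0 // => i _; move: (dual_step _ _ _ _) => d.
by have := l0 i; rewrite !mxE; case: (leP 0 (d i 0)) => d0 li; nra.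
Qed.

Lemma primal_step_optimal w z x :
  primal_step theta X A b beta Q w (dsubmx z) (usubmx z) -> X x ->
  0 <= theta x - theta (usubmx z)
       - dotv (2 *: dsubmx z - dsubmx w) (A *m (x - usubmx z))
       + beta * dotv (A *m (x - usubmx z)) (A *m (usubmx z - usubmx w))
       + dotv (x - usubmx z) (Q *m (usubmx z - usubmx w)).
Proof.
move=> zmin Xx.
pose y := usubmx z; pose u := x - y; pose v := y - usubmx w.
(* The coefficient of [s ^+ 2]: the quadratic terms expand exactly along [u], while [theta] is
   bounded by its chord. *)
pose d := beta / 2 * dotv (A *m u) (A *m u) + 1 / 2 * dotv u (Q *m u).
apply: (argmin_first_order (d := d) X_convex zmin Xx) => s s0 s1 /=.
have := convex_functionP theta_convex x y (ltW s0) (ltW s1).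
rewrite -/y; set x' := s *: x + _ => theta_le.
have x'y : x' = y + s *: u.
  by rewrite /x' /u scalerBr scalerBl scale1r addrCA addrA.
have -> : x' - usubmx w = v + s *: u by rewrite x'y addrAC.
have -> : A *m x' - b = (A *m y - b) + s *: (A *m u).
  by rewrite x'y mulmxDr -scalemxAr addrAC.
rewrite -/u -/v /d; clear d x'y; clearbody u v.
rewrite !sqnorm_mxE !mul1mx !mulmxDr -!scalemxAr !dotv_lin.
rewrite (dotvC (A *m v) (A *m u)) (dotv_sym v u Q_pd.1).
lra.
Qed.

(** The off-diagonal blocks of [H] absorb both mismatches: [- A^T] the extrapolation
    [2 *: dsubmx z - dsubmx w], and [- A] the use of the old primal point in the dual residual. *)
Lemma iteration_bound w z p :
  dual_optimal w z ->
  primal_step theta X A b beta Q w (dsubmx z) (usubmx z) ->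
  Omega c X p ->
  theta (usubmx z) - theta (usubmx p) + dotv (z - p) (F A b p)
  <= 1 / 2 * (sqnorm_mx (H A beta Q) (p - w)
              - sqnorm_mx (H A beta Q) (p - z)).
Proof.
move=> /[swap] zmin dopt [Xp Lp].
have Hzw := H_ge0 (z - w); have := three_point z w p H_sym.
set Hpw := sqnorm_mx _ (p - w); set Hpz := sqnorm_mx _ (p - z).
have := primal_step_optimal zmin Xp.
have : 0 <= dotv (dsubmx p - dsubmx z) (A *m usubmx w - b)
            + beta^-1 * dotv (dsubmx p - dsubmx z) (dsubmx z - dsubmx w).
  have dge0 := dopt _ Lp; rewrite dotvDr dotvZr in dge0.
  by rewrite -(pmulr_rge0 _ beta_gt0) mulrDr mulrA divff ?mul1r // gt_eqF.
(* Expanded into inner products, the claim is linear in them; skewness of [F] shows up as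
   cancellation. *)
rewrite dotv_H dotvE_submx /F col_mxKu col_mxKd !usubmxB !dsubmxB.
rewrite dotvNr dotv_trmx (dotvC (A *m _) (dsubmx p)).
rewrite !mulmxBr !dotv_lin.
lra.
Qed.

Lemma ergodic_sum_bound (w : nat -> 'cV[R]_(n + m)) t p :
  (forall k, dual_optimal (w k) (w k.+1)) ->
  (forall k, primal_step theta X A b beta Q (w k)
               (dsubmx (w k.+1)) (usubmx (w k.+1))) ->
  Omega c X p ->
  \sum_(k < t) (theta (usubmx (w k.+1)) - theta (usubmx p)
                + dotv (w k.+1 - p) (F A b p))
  <= 1 / 2 * (sqnorm_mx (H A beta Q) (p - w 0)
              - sqnorm_mx (H A beta Q) (p - w t)).
Proof.
move=> dopt popt Op; elim: t => [|t IH]; first by rewrite big_ord0; lra.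
by rewrite big_ord_recr /=; have := iteration_bound (dopt t) (popt t) Op; lra.
Qed.

Lemma optimal_steps_ergodic_bound (w : nat -> 'cV[R]_(n + m)) t :
  (forall k, dual_optimal (w k) (w k.+1)) ->
  (forall k, primal_step theta X A b beta Q (w k)
               (dsubmx (w k.+1)) (usubmx (w k.+1))) ->
  ergodic_bound c theta X A b beta Q w t.
Proof.
(* The mean has [t.+1] terms, the last being [w t.+1]; the leftover distance to it is dropped by
   [H_ge0]. *)
move=> dopt popt p Op; have := ergodic_sum_bound t.+1 dopt popt Op.
have := H_ge0 (p - w t.+1).
have := mean_convex_function (fun k => usubmx (w k.+1)) t theta_convex.
rewrite -(usubmx_mean (fun k => w k.+1)) -[mean _ t]/(ergodic_mean w t).
rewrite big_split sumrB sumr_const card_ord /=.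
rewrite -dotv_suml sumrB sumr_const card_ord.
rewrite -(mulr_natl (theta _)) -(scaler_nat t.+1 p).
have -> : ergodic_mean w t - p =
    t.+1%:R^-1 *: (\sum_(k < t.+1) w k.+1 - t.+1%:R *: p).
  by rewrite /ergodic_mean scalerBr scalerA mulVf ?scale1r // pnatr_eq0.
rewrite dotvZl invfM.
set N : R := t.+1%:R; have N0 : 0 < N by [].
have NV : N^-1 * N = 1 by rewrite mulVf // gt_eqF.
have NV0 : 0 <= N^-1 by rewrite invr_ge0 ltW.
set Hp0 := sqnorm_mx _ (p - w 0) => theta_le Hpt_ge0 sum_le.
have := ler_wpM2l NV0 sum_le; have := mulr_ge0 NV0 Hpt_ge0.
have : N^-1 * (N * theta (usubmx p)) = theta (usubmx p).
  by rewrite mulrA NV mul1r.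
by move: N^-1 theta_le => iN *; lra.
Qed.

(** * Membership of the mean in [Omega] *)

Lemma Lambda_convex : convex_set (Lambda c : set 'cV[R]_m).
Proof.
move=> x y s; rewrite !inE /Lambda; case: c => //= x0 y0 i.
by rewrite !mxE addr_ge0 // mulr_ge0 // subr_ge0.
Qed.

Lemma ergodic_mean_primal (w : nat -> 'cV[R]_(n + m)) t :
  (forall k, X (usubmx (w k.+1))) -> X (usubmx (ergodic_mean w t)).
Proof.
move=> Xw; rewrite (usubmx_mean (fun k => w k.+1)).
by apply: mean_convex_set X_convex _ => k _; exact: Xw.
Qed.

Lemma ergodic_mean_dual (w : nat -> 'cV[R]_(n + m)) t :
  (forall k, (k <= t)%N -> Lambda c (dsubmx (w k.+1))) ->
  Lambda c (dsubmx (ergodic_mean w t)).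
Proof.
move=> Lw; rewrite (dsubmx_mean (fun k => w k.+1)).
exact: mean_convex_set Lambda_convex _.
Qed.

Lemma proj_Lambda_in (l : 'cV[R]_m) : Lambda c (proj_Lambda c l).
Proof.
by rewrite /Lambda /proj_Lambda; case: c => //= i; rewrite mxE le_max lexx.
Qed.

End Iteration.

(* Without projection the multipliers can leave Lambda when the constraint is
   A x >= b, and then so can their mean (n = m = 1, theta = 0, X = R, A = Q = 1,
   b = 0, beta = 1, x^0 = 1, lam^0 = 0 gives lam^1 = lam^2 = -1).  Hence, for
   that constraint, Omega-membership of the mean is asserted when the multipliers
   stay in Lambda, and unconditionally for the projected multiplier update. *)
Theorem theorem3p3 (R : realType) (n m : nat) (c : constraint_kind)
    (theta : 'cV[R]_n -> R) (X : set 'cV[R]_n)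
    (A : 'M[R]_(m, n)) (b : 'cV[R]_m) (beta : R) (Q : 'M[R]_n)
    (theta_cc : closed_convex_fun theta)
    (X_nonempty : X !=set0) (X_closed : closed X) (X_convex : convex_set X)
    (has_solution : argmin (feasible c X A b) theta !=set0)
    (beta_gt0 : 0 < beta) (Q_pd : sym_posdef Q)
    (w : nat -> 'cV[R]_(n + m)) (t : nat) (t_gt0 : (0 < t)%N) :
  (dual_primal_seq theta X A b beta Q w ->
     [/\ X (usubmx (ergodic_mean w t)),
         (c = EqC \/
          forall k : nat, (k <= t)%N -> Lambda c (dsubmx (w k.+1))) ->
           Omega c X (ergodic_mean w t)
       & ergodic_bound c theta X A b beta Q w t])
  /\
  (proj_dual_primal_seq c theta X A b beta Q w ->
     Omega c X (ergodic_mean w t) /\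
     ergodic_bound c theta X A b beta Q w t).
Proof.
have [theta_convex _] := theta_cc; split => step.
- have popt k := (step k).2; split.
  + by apply: ergodic_mean_primal => // k; case: (popt k).
  + move=> Lw; split.
      by apply: ergodic_mean_primal => // k; case: (popt k).
    (* For equality constraints [Lambda] is the whole space. *)
    by case: Lw => [-> //|]; exact: ergodic_mean_dual.
  + apply: optimal_steps_ergodic_bound => // k.
    exact/dual_step_optimal/(step k).1.
- have popt k := (step k).2; split.
    split; first by apply: ergodic_mean_primal => // k; case: (popt k).
    apply: ergodic_mean_dual => k _; rewrite (step k).1.
    exact: proj_Lambda_in.
  apply: optimal_steps_ergodic_bound => // k.
  exact/proj_dual_step_optimal/(step k).1.
Qed.
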